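(* Let $G=(V,E)$ be an infinite, locally finite and locally connected graph, let $Q:V\to\mathbb{R}$, let $L=-\Delta+Q$, and let $\mu\in\mathbb{R}$. Assume that there is a positive function $u$ on $V$ such that $$Lu(x)\ge\mu\,u(x)\quad\text{for all }x\in V.$$ Then $\mu_1(Q)\ge\mu$.
   Context: Write $x\sim y$ if there is an edge between $x$ and $y$, and $N(x)=\{y\in V: y\sim x,\ y\ne x\}$. Infinite means that $V$ is an infinite set. $G$ is locally finite: there is a constant $c>0$ with $d_x:=\#\{y\in V:y\sim x\}\le c$ for all $x\in V$. $G$ is locally connected: each $N(x)$ is connected, in the sense that for any $y_0,y_1\in N(x)$ there are two paths $P_+=y_0\sim x_1\sim\dots\sim x_m\sim y_1$ and $P_-=y_0\sim z_1\sim\dots\sim z_n\sim y_1$ connecting $y_0$ and $y_1$, with all $x_i,z_i\in N(x)$, and one then has the decomposition $N(x)=P_+\cup P_-$. The Laplacian is $\Delta f(x)=\frac1{d_x}\sum_{y\sim x}(f(y)-f(x))$, and $Lf(x)=-\Delta f(x)+Q(x)f(x)$. For a finite set $S\subset V$ whose induced subgraph is connected, $\delta S$ is the set of vertices not in $S$ that are adjacent to some vertex of $S$, $\int_S f\,dx=\sum_{x\in S}f(x)d_x$, and the first Dirichlet eigenvalue of $L$ on $S$ is $$\mu_1(S)=\inf\Big\{\int_S f\,Lf\,dx:\ f:S\cup\delta S\to\mathbb{R},\ f|_{\delta S}=0,\ \int_S f^2dx=1\Big\}.$$ The principal eigenvalue of $L$ is $\mu_1(Q)=\inf_S\mu_1(S)$,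 the infimum over all nonempty finite $S\subset V$ whose induced subgraph is connected. *)

(* Defs.v *)
From HB Require Import structures.
From mathcomp Require Import all_boot all_order all_algebra.
From mathcomp Require Import finmap.
From mathcomp Require Import all_classical all_reals all_analysis.
Set Implicit Arguments.
Unset Strict Implicit.
Unset Printing Implicit Defensive.
Import Order.TTheory GRing.Theory Num.Theory.
Local Open Scope classical_set_scope.
Local Open Scope ring_scope.

(* A graph is a symmetric boolean relation [e] on the vertex type [V]; there
   are no multiple edges, and loops are allowed.  Taking [V] to be a choiceType
   costs no generality, since every type carries such a structure
   classically. *)
Section Graph.
Variables (V : choiceType) (e : rel V).

Definition adjacent (x : V) : set V := [set y | e y x].

Definition nbrs (x : V) : set V := [set y | e y x /\ y != x].

(* [fset_set A] is empty when [A] is infinite, so [deg x] is meaningful only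
   if [adjacent x] is finite. *)
Definition deg (x : V) : nat := #|` fset_set (adjacent x)|%fset.

Definition locally_finite : Prop :=
  exists2 c : nat, (0 < c)%N &
    forall x, finite_set (adjacent x) /\ (deg x <= c)%N.

(* The vertices of the path are [x :: p].  Repeated vertices are allowed, and
   [p = [::]] is the trivial path from [x] to itself. *)
Definition path_in (A : set V) (x y : V) (p : seq V) : Prop :=
  [/\ path e x p, last x p = y & [set` x :: p] `<=` A].

Definition locally_connected : Prop :=
  forall x y0 y1, nbrs x y0 -> nbrs x y1 ->
    exists p q : seq V,
      [/\ path_in (nbrs x) y0 y1 p, path_in (nbrs x) y0 y1 q
        & nbrs x = [set` y0 :: p] `|` [set` y0 :: q]].

Definition induced_connected (S : {fset V}) : Prop :=
  forall x y, x \in S -> y \in S -> exists p, path_in [set` S] x y p.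

Definition boundary (S : {fset V}) : set V :=
  [set y | y \notin S /\ exists2 x, x \in S & e y x].

End Graph.

Section Operator.
Variables (R : realType) (V : choiceType) (e : rel V).

(* At an isolated vertex the sum is empty and the Laplacian is 0. *)
Definition laplacian (f : V -> R) (x : V) : R :=
  (deg e x)%:R^-1 * \sum_(y \in adjacent e x) (f y - f x).

Definition schrodinger (Q f : V -> R) (x : V) : R :=
  - laplacian f x + Q x * f x.

Definition integral_on (S : {fset V}) (f : V -> R) : R :=
  \sum_(x <- S) f x * (deg e x)%:R.

(* Test functions are given on all of [V], but the constraints and the
   integral only involve their values on [S] and its boundary.  The infima are
   taken in the extended reals: an infimum over the empty set is [+oo], and
   [principal_eigenvalue] may be [-oo]. *)
Definition dirichlet_eigenvalue (Q : V -> R) (S : {fset V}) : \bar R :=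
  ereal_inf [set (integral_on S (fun x => f x * schrodinger Q f x))%:E
            | f in [set f : V -> R |
                (forall x, boundary e S x -> f x = 0) /\
                integral_on S (fun x => f x ^+ 2) = 1]].

Definition principal_eigenvalue (Q : V -> R) : \bar R :=
  ereal_inf [set dirichlet_eigenvalue Q S
            | S in [set S : {fset V} | S != fset0 /\ induced_connected e S]].

End Operator.

(* Main.v *)
Require Import Defs.
From mathcomp Require Import all_boot all_order all_algebra.
From mathcomp Require Import finmap.
From mathcomp Require Import all_classical all_reals all_analysis.
From mathcomp Require Import ring lra.
Import Order.TTheory GRing.Theory Num.Theory.
Local Open Scope classical_set_scope.
Local Open Scope ring_scope.

(** This is Barta's argument.  Let [f] be a test function on [S].  Multiplying
    the inequality [mu * u <= L u] at [x] by the nonnegative weight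
    [deg x * f x ^+ 2 / u x] bounds the potential from below and removes it
    from the energy of [f]:
    [deg x * f x * (L f x - mu * f x)] is at least the sum over the neighbours
    [y] of [x] of the defect [f x ^+ 2 * u y / u x - f x * f y]
    ([energy_density_ge]).  The defect is not pointwise nonnegative, but its
    sum over the two orientations of an edge is a weighted square,
    [u x * u y * (f x / u x - f y / u y) ^+ 2] ([defect_symm_ge0]), and on an
    edge that leaves [S] it is nonnegative because [f] vanishes at the outer
    end.  Summing over [S] gives the bound [mu] on every Dirichlet eigenvalue
    ([dirichlet_eigenvalue_ge]), hence on their infimum. *)

(** Multiplying by the degree clears the denominator of the Laplacian, also at
    an isolated vertex, where the inverse of the degree is a default value but
    both sides vanish. *)
Lemma deg_laplacian (R : realType) (V : choiceType) (e : rel V) (f : V -> R)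
    (x : V) : finite_set (Defs.adjacent e x) ->
  (deg e x)%:R * laplacian e f x
    = \sum_(y <- fset_set (Defs.adjacent e x)) (f y - f x).
Proof.
move=> fin_x; rewrite /laplacian fsbig_finite //.
have [deg0|deg_neq0] := eqVneq (deg e x) 0%N.
  have -> : fset_set (Defs.adjacent e x) = fset0 by exact: cardfs0_eq.
  by rewrite big_seq_fset0 !mulr0.
by rewrite mulrA mulfV ?mul1r // pnatr_eq0.
Qed.

Section Defect.
Variables (R : realType) (V : choiceType) (u f : V -> R).
Hypothesis u_gt0 : forall x, 0 < u x.

(** Up to the factor [u x * u y], this is [h x * (h x - h y)] for the quotient
    [h = f / u]: one orientation's share of the Dirichlet form of [h]. *)
Definition defect (x y : V) : R := f x ^+ 2 * u y / u x - f x * f y.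

Lemma defect_symm_ge0 (x y : V) : 0 <= defect x y + defect y x.
Proof.
have -> : defect x y + defect y x = u x * u y * (f x / u x - f y / u y) ^+ 2.
  by rewrite /defect; field; rewrite !gt_eqF.
by rewrite mulr_ge0 ?sqr_ge0 // mulr_ge0 // ltW.
Qed.

Lemma defect_ge0 (x y : V) : f y = 0 -> 0 <= defect x y.
Proof.
move=> fy0; rewrite /defect fy0 mulr0 subr0.
by apply: divr_ge0; [apply: mulr_ge0; [exact: sqr_ge0|]|]; exact: ltW.
Qed.

End Defect.
Arguments defect {R V} u f x y.

(** Exchanging the two summation variables pairs each term with its
    transpose. *)
Lemma sum_symm_ge0 (R : realType) (V : choiceType) (e : rel V) (s : seq V)
    (a : V -> V -> R) : symmetric e -> (forall x y, 0 <= a x y + a y x) ->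
  0 <= \sum_(x <- s) \sum_(y <- s | e y x) a x y.
Proof.
move=> e_sym a_ge0; set D := (X in 0 <= X).
have DE : D = \sum_(x <- s) \sum_(y <- s | e y x) a y x.
  rewrite /D (exchange_big_dep xpredT) //=; apply: eq_bigr => y _.
  by apply: eq_bigl => x; rewrite e_sym.
suff : 0 <= D + D by lra.
rewrite {2}DE /D -big_split /=; apply: sumr_ge0 => x _.
by rewrite -big_split /=; apply: sumr_ge0 => y _.
Qed.

Section Supersolution.
Variables (R : realType) (V : choiceType) (e : rel V).
Variables (Q u : V -> R) (mu : R).
Hypothesis e_sym : symmetric e.
Hypothesis adj_fin : forall x, finite_set (Defs.adjacent e x).
Hypothesis u_gt0 : forall x, 0 < u x.
Hypothesis u_super : forall x, mu * u x <= schrodinger e Q u x.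

(** The difference of the two sides is [deg x * f x ^+ 2 / u x] times
    [L u x - mu * u x]: the weight is chosen so that [Q x] enters both in the
    same way and cancels. *)
Lemma energy_density_ge (f : V -> R) (x : V) :
  mu * (f x ^+ 2 * (deg e x)%:R)
      + \sum_(y <- fset_set (Defs.adjacent e x)) defect u f x y
    <= f x * schrodinger e Q f x * (deg e x)%:R.
Proof.
have ux0 : u x != 0 by rewrite gt_eqF.
have w_ge0 : 0 <= (deg e x)%:R * (f x ^+ 2 / u x).
  by apply: mulr_ge0 => //; apply: divr_ge0; [exact: sqr_ge0|exact: ltW].
(* The diagonal terms [f x ^+ 2] of the two Laplacians cancel. *)
have defectE : \sum_(y <- fset_set (Defs.adjacent e x)) defect u f x y
    = f x ^+ 2 / u x * ((deg e x)%:R * laplacian e u x)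
      - f x * ((deg e x)%:R * laplacian e f x).
  rewrite !deg_laplacian // !mulr_sumr -sumrB; apply: eq_bigr => y _.
  by rewrite /defect; field.
rewrite -subr_ge0 defectE.
have := mulr_ge0 w_ge0 (etrans (subr_ge0 _ _) (u_super x)).
congr (0 <= _).
by rewrite /schrodinger; field.
Qed.

Lemma sum_defect_ge0 (S : {fset V}) (f : V -> R) :
    (forall x, boundary e S x -> f x = 0) ->
  0 <= \sum_(x <- S) \sum_(y <- fset_set (Defs.adjacent e x)) defect u f x y.
Proof.
move=> f0.
apply: le_trans (sum_symm_ge0 R V e S _ e_sym (defect_symm_ge0 R V u f u_gt0)) _.
(* What remains is the contribution of the edges that leave [S]. *)
rewrite big_seq [leRHS]big_seq; apply: ler_sum => x xS.
rewrite [leRHS](bigID (fun y => y \in S)) /=.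
have -> : \sum_(y <- fset_set (Defs.adjacent e x) | y \in S) defect u f x y
    = \sum_(y <- S | e y x) defect u f x y.
  rewrite -big_filter -[RHS]big_filter; apply: perm_big.
  apply: uniq_perm; rewrite ?filter_uniq ?fset_uniq // => y.
  by rewrite !mem_filter in_fset_set // andbC; congr (_ && _); apply: asboolb.
rewrite lerDl big_seq_cond; apply: sumr_ge0 => y /andP[].
rewrite in_fset_set // inE => e_yx yS.
by apply: defect_ge0 => //; apply: f0; split=> //; exists x.
Qed.

Lemma dirichlet_eigenvalue_ge (S : {fset V}) :
  (mu%:E <= dirichlet_eigenvalue e Q S)%E.
Proof.
apply: le_ereal_inf_tmp => _ [f [f0 f1] <-]; rewrite lee_fin.
rewrite -[leLHS]mulr1 -f1 /integral_on mulr_sumr.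
apply: le_trans (ler_sum _ (fun x _ => energy_density_ge f x)).
by rewrite big_split /= lerDl sum_defect_ge0.
Qed.

End Supersolution.

Theorem theorem10 (R : realType) (V : choiceType) (e : rel V)
    (e_sym : symmetric e)
    (V_infinite : infinite_set [set: V])
    (e_fin : locally_finite e)
    (e_conn : locally_connected e)
    (Q : V -> R) (mu : R)
    (supersol : exists u : V -> R,
        (forall x, 0 < u x) /\
        (forall x, mu * u x <= schrodinger e Q u x)) :
  (mu%:E <= principal_eigenvalue e Q)%E.
Proof.
have [u [u_gt0 u_super]] := supersol.
have [c _ adj_fin] := e_fin.
apply: le_ereal_inf_tmp => _ [S _ <-].
by apply: (dirichlet_eigenvalue_ge R V e Q u) => // x; have [] := adj_fin x.
Qed.
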